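(* Let $t\mapsto x(t)\in\mathbf{R}^3$ be an elastica parametrized by arclength, with curvature $\kappa$, torsion $\tau$, conserved linear momentum $p$ and conserved angular momentum $l$, and suppose that $\dot x$ is not parallel to $p$. Let $$D=\frac{\dot x\times p}{|\dot x\times p|},\qquad E=\frac{(\dot x\times p)\times p}{|(\dot x\times p)\times p|}.$$ Then the frame $(D(t),E(t))$ satisfies the equations $$\dot D=-\frac{\langle l,p\rangle\,|p|}{2(|p|^2-\kappa^4)}\,E,\qquad \dot E=\frac{\langle l,p\rangle\,|p|}{2(|p|^2-\kappa^4)}\,D,$$ where $\kappa^2\tau=-\frac14\langle l,p\rangle$.
   Context: An elastica is a curve in $\mathbf{R}^3$ satisfying the Euler-Lagrange equations $\frac{\partial L}{\partial x}-\frac{d}{dt}\frac{\partial L}{\partial\dot x}+\frac{d^2}{dt^2}\frac{\partial L}{\partial\ddot x}=0$ for the Lagrangian $$L(x,\dot x,\ddot x)=\frac{|\ddot x|^2}{|\dot x|^3}-\frac{\langle\dot x,\ddot x\rangle^2}{|\dot x|^5},\qquad\dot x\ne0.$$ Put $p_{\dot x}=\frac{\partial L}{\partial\ddot x}$ and $p=p_x=\frac{\partial L}{\partial\dot x}-\frac{d}{dt}\frac{\partial L}{\partial\ddot x}$ (linear momentum), and $l=x\times p_x+\dot x\times p_{\dot x}$ (angular momentum); both $p$ and $l$ are constant along the elastica. In the arclength parametrization ($|\dot x|=1$), $p=-2\dddot x-3\langle\ddot x,\ddot x\rangle\dot x$ and $l=x\times p+2\dot x\times\ddot x$. The Frenet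 frame $(T,N,B)$ with $T=\dot x$ (defined where $\kappa=|\ddot x|\neq0$) satisfies $\dot T=\kappa N$, $\dot N=-\kappa T+\tau B$, $\dot B=-\tau N$, $B=T\times N$, with $\kappa$ the curvature and $\tau$ the torsion. *)

(* Defs.v *)
From HB Require Import structures.
From mathcomp Require Import all_boot all_order all_algebra.
From mathcomp Require Import all_classical all_reals all_analysis.

Set Implicit Arguments.
Unset Strict Implicit.
Unset Printing Implicit Defensive.

Import Order.TTheory GRing.Theory Num.Theory.
Import numFieldNormedType.Exports.

Local Open Scope ring_scope.

Section Space.
Context {R : realType}.
Implicit Types u v : 'rV[R]_3.

Definition dotmul u v : R := \sum_i u 0 i * v 0 i.

(* Not [`|u|], which is the sup norm on matrices. *)
Definition enorm u : R := Num.sqrt (dotmul u u).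

(* Indices are taken modulo 3, in the ring structure of 'I_3. *)
Definition crossmul u v : 'rV[R]_3 :=
  \row_i (u 0 (i + 1) * v 0 (i + 2) - u 0 (i + 2) * v 0 (i + 1)).

Definition normalize u : 'rV[R]_3 := (enorm u)^-1 *: u.

(* The zero vector is parallel to every vector. *)
Definition parallel u v : Prop :=
  (exists c : R, u = c *: v) \/ (exists c : R, v = c *: u).

Definition grad (f : 'rV[R]_3 -> R) u : 'rV[R]_3 :=
  \row_i 'D_(delta_mx 0 i) f u.

End Space.

Section SecondOrderLagrangian.
Context {R : realType}.
(* The arguments of L are position, velocity and acceleration. *)
Variable L : 'rV[R]_3 -> 'rV[R]_3 -> 'rV[R]_3 -> R.
Variable x : R -> 'rV[R]_3.

Definition dL_dpos (t : R) : 'rV[R]_3 :=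
  grad (fun q => L q (derive1 x t) (derive1n 2 x t)) (x t).
Definition dL_dvel (t : R) : 'rV[R]_3 :=
  grad (fun v => L (x t) v (derive1n 2 x t)) (derive1 x t).
Definition dL_dacc (t : R) : 'rV[R]_3 :=
  grad (fun a => L (x t) (derive1 x t) a) (derive1n 2 x t).

Definition euler_lagrange (t : R) : Prop :=
  dL_dpos t - derive1 dL_dvel t + derive1n 2 dL_dacc t = 0.

Definition momentum_pos (t : R) : 'rV[R]_3 := dL_dvel t - derive1 dL_dacc t.
Definition momentum_vel (t : R) : 'rV[R]_3 := dL_dacc t.

End SecondOrderLagrangian.

Section Elastica.
Context {R : realType}.

Definition elastic_lagrangian (q v a : 'rV[R]_3) : R :=
  enorm a ^+ 2 / enorm v ^+ 3 - dotmul v a ^+ 2 / enorm v ^+ 5.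

(* The Euler-Lagrange equation has order four, whence the regularity. *)
Definition elastica (I : set R) (x : R -> 'rV[R]_3) : Prop :=
  [/\ forall (k : nat) t, (k < 4)%N -> I t -> derivable (derive1n k x) t 1,
      forall t, I t -> derive1 x t != 0 &
      forall t, I t -> euler_lagrange elastic_lagrangian x t].

Definition arclength_parametrized (I : set R) (x : R -> 'rV[R]_3) : Prop :=
  forall t, I t -> enorm (derive1 x t) = 1.

Variable x : R -> 'rV[R]_3.

Definition linear_momentum : R -> 'rV[R]_3 := momentum_pos elastic_lagrangian x.

Definition angular_momentum (t : R) : 'rV[R]_3 :=
  crossmul (x t) (linear_momentum t) +
  crossmul (derive1 x t) (momentum_vel elastic_lagrangian x t).

(* Frenet apparatus of a curve parametrized by arclength. *)
Definition curvature (t : R) : R := enorm (derive1n 2 x t).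
Definition frenet_tangent (t : R) : 'rV[R]_3 := derive1 x t.
Definition frenet_normal (t : R) : 'rV[R]_3 :=
  (curvature t)^-1 *: derive1 frenet_tangent t.
Definition frenet_binormal (t : R) : 'rV[R]_3 :=
  crossmul (frenet_tangent t) (frenet_normal t).

(* The B-component of the derivative of N. It is meaningful only where the
   curvature is nonzero; elsewhere curvature ^+ 2 * torsion is 0. *)
Definition torsion (t : R) : R :=
  dotmul (derive1 frenet_normal t) (frenet_binormal t).

Definition frameD (t : R) : 'rV[R]_3 :=
  normalize (crossmul (derive1 x t) (linear_momentum t)).
Definition frameE (t : R) : 'rV[R]_3 :=
  normalize
    (crossmul (crossmul (derive1 x t) (linear_momentum t)) (linear_momentum t)).

End Elastica.

(* Main.v *)
Require Import Defs.
From HB Require Import structures.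
From mathcomp Require Import all_boot all_order all_algebra.
From mathcomp Require Import all_classical all_reals all_analysis.
From mathcomp Require Import ring lra.

(** Write v, a, b for the first three derivatives of x, and p for the linear
    momentum. Differentiating L along lines at a unit v orthogonal to a gives
    dL/dv = - 3 <a, a> v and dL/da = 2 a, so that p = - 3 <a, a> v - 2 b near t
    ([linear_momentum_arclength]), and the Euler-Lagrange equation says exactly
    that p' = 0 ([is_derive_linear_momentum]). From <v, v> = 1 one gets
    <v, a> = 0 and <v, b> = - <a, a>, hence <v, p> = - kappa^2 and, by
    Lagrange's identity, |v x p|^2 = |p|^2 - kappa^4
    ([enorm_velocity_momentum_sqr]). Moreover <l, p> = 2 det(v, a, p), and
    det(v, a, p) = - 2 det(v, a, b) = - 2 kappa^2 tau.

    The two frame equations are two instances of a single fact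
    ([is_derive_normalize_crossmul]): for a curve f and a vector p stationary
    at t, the derivative of the unit vector along w = f x p is
    - det(f, f', p) / |w|^3 times w x p. Indeed it is orthogonal to w because
    the vector has unit length, and orthogonal to p because w stays so.
    Taking f = v gives D' along (v x p) x p, that is along E. Taking f = v x p
    gives E' along ((v x p) x p) x p = - |p|^2 (v x p), that is along D. As
    v x p and p are orthogonal, |(v x p) x p| = |v x p| |p|, and both
    coefficients become det(v, a, p) |p| / |v x p|^2 up to sign. *)

Set Implicit Arguments.
Unset Strict Implicit.
Unset Printing Implicit Defensive.

Import Order.TTheory GRing.Theory Num.Theory.
Import numFieldNormedType.Exports.

Local Open Scope ring_scope.

(** * Coordinates in dimension three *)

Section Coordinates.
Context {R : realType}.
Implicit Types (u v : 'rV[R]_3) (c : R).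

Lemma ord3_cases (i : 'I_3) : [\/ i = 0, i = 1 | i = 2].
Proof.
case: i => -[|[|[|//]]] lti; [apply: Or31|apply: Or32|apply: Or33];
  exact: val_inj.
Qed.

Lemma row3_eq u v :
  u 0 0 = v 0 0 -> u 0 1 = v 0 1 -> u 0 2 = v 0 2 -> u = v.
Proof. by move=> ? ? ?; apply/rowP => i; case: (ord3_cases i) => ->. Qed.

Lemma dotmulE u v :
  dotmul u v = u 0 0 * v 0 0 + u 0 1 * v 0 1 + u 0 2 * v 0 2.
Proof.
rewrite /dotmul !big_ord_recl big_ord0 addr0 addrA.
by congr (_ * _ + _ * _ + _ * _); congr (_ 0 _); apply: val_inj.
Qed.

Lemma crossmulE u v :
  (crossmul u v 0 0 = u 0 1 * v 0 2 - u 0 2 * v 0 1) *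
  (crossmul u v 0 1 = u 0 2 * v 0 0 - u 0 0 * v 0 2) *
  (crossmul u v 0 2 = u 0 0 * v 0 1 - u 0 1 * v 0 0).
Proof.
rewrite !mxE.
have -> : 1 + 1 = 2 :> 'I_3 by exact: val_inj.
have -> : 1 + 2 = 0 :> 'I_3 by exact: val_inj.
have -> : 2 + 1 = 0 :> 'I_3 by exact: val_inj.
have -> : 2 + 2 = 1 :> 'I_3 by exact: val_inj.
by rewrite !add0r.
Qed.

Lemma add_rowE u v i : (u + v) 0 i = u 0 i + v 0 i.
Proof. by rewrite mxE. Qed.

Lemma opp_rowE u i : (- u) 0 i = - u 0 i.
Proof. by rewrite mxE. Qed.

Lemma scale_rowE c u i : (c *: u) 0 i = c * u 0 i.
Proof. by rewrite mxE. Qed.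

Lemma zero_rowE i : (0 : 'rV[R]_3) 0 i = 0.
Proof. by rewrite mxE. Qed.

(** Replaces [mxE], which would unfold [crossmul] into its definition with
    indices modulo 3 instead of using [crossmulE]. *)
Definition rowE :=
  (dotmulE, crossmulE, add_rowE, opp_rowE, scale_rowE, zero_rowE).

End Coordinates.

Local Ltac row_ring := try apply: row3_eq; rewrite !rowE; ring.

(** * Dot and cross products *)

Section VectorAlgebra.
Context {R : realType}.
Implicit Types (u v w p : 'rV[R]_3) (c : R).

Lemma dotmulC u v : dotmul u v = dotmul v u.
Proof. row_ring. Qed.

Lemma dotmulDl u v w : dotmul (u + v) w = dotmul u w + dotmul v w.
Proof. row_ring. Qed.

Lemma dotmulZl c u v : dotmul (c *: u) v = c * dotmul u v.
Proof. row_ring. Qed.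

Lemma crossmul_crossmul u v w :
  crossmul (crossmul u v) w = dotmul u w *: v - dotmul v w *: u.
Proof. row_ring. Qed.

Lemma dotmul_crossmulr u v : dotmul (crossmul u v) v = 0.
Proof. row_ring. Qed.

(** (u x p) x (v x p) = det(u, v, p) p. *)
Lemma dotmul_crossmul_crossmul u v p :
  dotmul (crossmul (crossmul u p) (crossmul v p)) p =
  dotmul (crossmul u v) p * dotmul p p.
Proof. row_ring. Qed.

Lemma lagrange_identity u v :
  dotmul (crossmul u v) (crossmul u v) =
  dotmul u u * dotmul v v - dotmul u v ^+ 2.
Proof. row_ring. Qed.

(** The left-hand side is (w x z) x w, and w x z = (u x p) x (v x p) is
    det(u, v, p) p. *)
Lemma gram_schmidt_crossmul u v p (w := crossmul u p) (z := crossmul v p) :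
  dotmul w w *: z - dotmul w z *: w =
  - dotmul (crossmul u v) p *: crossmul w p.
Proof. rewrite /w /z; row_ring. Qed.

Lemma dotmul_ge0 u : 0 <= dotmul u u.
Proof. by rewrite /dotmul sumr_ge0// => i _; rewrite -expr2 sqr_ge0. Qed.

Lemma dotmul_eq0 u : (dotmul u u == 0) = (u == 0).
Proof.
apply/idP/eqP => [|->]; last by apply/eqP; row_ring.
rewrite /dotmul psumr_eq0 => [/allP u0|i _]; last by rewrite -expr2 sqr_ge0.
apply/rowP => i; rewrite mxE; apply/eqP.
by have := u0 i (mem_index_enum i); rewrite mulf_eq0 orbb.
Qed.

Lemma enorm_sqr u : enorm u ^+ 2 = dotmul u u.
Proof. by rewrite sqr_sqrtr// dotmul_ge0. Qed.

Lemma enorm_eq0 u : (enorm u == 0) = (u == 0).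
Proof. by rewrite -dotmul_eq0 -enorm_sqr sqrf_eq0. Qed.

Lemma enorm_crossmul_orthogonal u v :
  dotmul u v = 0 -> enorm (crossmul u v) = enorm u * enorm v.
Proof.
move=> uv0; rewrite /enorm lagrange_identity uv0 expr0n subr0.
by rewrite sqrtrM// dotmul_ge0.
Qed.

(** The triple product (u x v) x u = <u, u> v - <v, u> u vanishes. *)
Lemma crossmul_eq0_parallel u v :
  u != 0 -> crossmul u v = 0 -> parallel u v.
Proof.
move=> u0 uv0; right; exists (dotmul v u / dotmul u u).
have := crossmul_crossmul u v u; rewrite uv0.
have -> : crossmul 0 u = 0 by row_ring.
move/esym/subr0_eq => e.
by rewrite mulrC -scalerA -e scalerA mulVf ?scale1r// dotmul_eq0.
Qed.

End VectorAlgebra.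

(** * Derivatives of vector-valued functions *)

Section VectorCalculus.
Context {R : realType}.
Implicit Types (f g : R -> 'rV[R]_3) (u v w p : 'rV[R]_3) (t : R).

Lemma is_derive_row f t v :
  is_derive t 1 f v <->
  forall i, is_derive t 1 (fun s => f s 0 i) (v 0 i).
Proof.
split=> [[df <-] i|df].
  apply: DeriveDef; first by move/derivable_mxP: df.
  by rewrite derive_mx// mxE.
have dvf : derivable f t 1.
  by apply/derivable_mxP => j i; rewrite ord1; case: (df i).
apply: DeriveDef => //; apply/rowP => i.
by rewrite derive_mx// mxE; case: (df i).
Qed.

Lemma is_derive_dotmul f g t v w :
  is_derive t 1 f v -> is_derive t 1 g w ->
  is_derive t 1 (fun s => dotmul (f s) (g s)) (dotmul v (g t) + dotmul (f t) w).
Proof.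
move=> /is_derive_row df /is_derive_row dg.
have -> : (fun s => dotmul (f s) (g s)) =
  (fun s => f s 0 0) * (fun s => g s 0 0) +
  (fun s => f s 0 1) * (fun s => g s 0 1) +
  (fun s => f s 0 2) * (fun s => g s 0 2).
  by apply/funext => s; rewrite dotmulE.
apply: is_derive_eq (is_deriveD (is_deriveD (is_deriveM (df 0) (dg 0))
  (is_deriveM (df 1) (dg 1))) (is_deriveM (df 2) (dg 2))) _.
by rewrite /GRing.scale/=; row_ring.
Qed.

Lemma is_derive_crossmul f g t v w :
  is_derive t 1 f v -> is_derive t 1 g w ->
  is_derive t 1 (fun s => crossmul (f s) (g s))
    (crossmul v (g t) + crossmul (f t) w).
Proof.
move=> /is_derive_row df /is_derive_row dg; apply/is_derive_row => i.
have -> : (fun s => crossmul (f s) (g s) 0 i) =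
  (fun s => f s 0 (i + 1)) * (fun s => g s 0 (i + 2)) -
  (fun s => f s 0 (i + 2)) * (fun s => g s 0 (i + 1)).
  by apply/funext => s; rewrite mxE.
apply: is_derive_eq (is_deriveB (is_deriveM (df (i + 1)) (dg (i + 2)))
  (is_deriveM (df (i + 2)) (dg (i + 1)))) _.
by rewrite /GRing.scale/= !mxE; ring.
Qed.

Lemma is_derive_crossmul_stationary f g t v :
  is_derive t 1 f v -> is_derive t 1 g 0 ->
  is_derive t 1 (fun s => crossmul (f s) (g s)) (crossmul v (g t)).
Proof.
move=> df dg; apply: is_derive_eq (is_derive_crossmul df dg) _.
have -> : crossmul (f t) 0 = 0 by row_ring.
by rewrite addr0.
Qed.

Lemma is_derive_scale (c : R -> R) f t (b : R) v :
  is_derive t 1 c b -> is_derive t 1 f v ->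
  is_derive t 1 (fun s => c s *: f s) (b *: f t + c t *: v).
Proof.
move=> dc /is_derive_row df; apply/is_derive_row => i.
have -> : (fun s => (c s *: f s) 0 i) = c * (fun s => f s 0 i).
  by apply/funext => s; rewrite mxE.
apply: is_derive_eq (is_deriveM dc (df i)) _.
by rewrite /GRing.scale/= !mxE; ring.
Qed.

Lemma is_derive_enorm f t v : f t != 0 -> is_derive t 1 f v ->
  is_derive t 1 (fun s => enorm (f s)) (dotmul (f t) v / enorm (f t)).
Proof.
move=> ft0 df.
have dff := is_derive_dotmul df df.
have ds : is_derive (dotmul (f t) (f t)) 1 Num.sqrt (2 * enorm (f t))^-1.
  by apply: is_derive1_sqrt; rewrite lt_def dotmul_eq0 ft0 dotmul_ge0.
apply: is_derive_eq (@is_derive1_comp _ _ _ _ _ _ ds dff) _.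
by rewrite [dotmul v _]dotmulC; field; rewrite enorm_eq0.
Qed.

Lemma is_derive_enormV f t v : f t != 0 -> is_derive t 1 f v ->
  is_derive t 1 (fun s => (enorm (f s))^-1)
    (- (dotmul (f t) v / enorm (f t) ^+ 3)).
Proof.
move=> ft0 df; have nf0 : enorm (f t) != 0 by rewrite enorm_eq0.
apply: is_derive_eq (@is_deriveV _ (fun s => enorm (f s)) _ _ _ nf0
  (is_derive_enorm ft0 df)) _.
by rewrite /GRing.scale/=; field.
Qed.

Lemma is_derive_normalize f t v : f t != 0 -> is_derive t 1 f v ->
  is_derive t 1 (fun s => normalize (f s))
    ((enorm (f t) ^+ 3)^-1 *:
       (dotmul (f t) (f t) *: v - dotmul (f t) v *: f t)).
Proof.
move=> ft0 df; have nf0 : enorm (f t) != 0 by rewrite enorm_eq0.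
apply: is_derive_eq (is_derive_scale (is_derive_enormV ft0 df) df) _.
rewrite -enorm_sqr scalerBr addrC !scalerA -scaleNr.
by congr (_ *: _ + _ *: _); field.
Qed.

(** Both frame vectors have the form normalize (f x g) with g stationary. The
    derivative is orthogonal to the vector itself and to g t, hence along
    (f x g) x g; [gram_schmidt_crossmul] computes the coefficient. *)
Lemma is_derive_normalize_crossmul f g t v
    (p := g t) (w := crossmul (f t) p) :
  is_derive t 1 f v -> is_derive t 1 g 0 -> w != 0 ->
  is_derive t 1 (fun s => normalize (crossmul (f s) (g s)))
    (- (dotmul (crossmul (f t) v) p / enorm w ^+ 3) *: crossmul w p).
Proof.
move=> df dg w0; have dw := is_derive_crossmul_stationary df dg.
apply: is_derive_eq (@is_derive_normalize _ _ _ w0 dw) _.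
by rewrite gram_schmidt_crossmul scalerA -mulrN mulrC mulNr mulrN.
Qed.

Lemma near_cst_dotmul f g t v w (c : R) :
  is_derive t 1 f v -> is_derive t 1 g w ->
  (\forall s \near t, dotmul (f s) (g s) = c) ->
  dotmul v (g t) + dotmul (f t) w = 0.
Proof.
move=> df dg fgc.
have [_ <-] := is_derive_dotmul df dg.
by rewrite (near_eq_derive (1 : R) (g := cst c) fgc) derive_cst.
Qed.

Lemma near_eq_derive1 f g t :
  (\near t, f t = g t) -> derive1 f t = derive1 g t.
Proof. by move=> fg; rewrite !derive1E; exact: near_eq_derive. Qed.

Lemma is_derive_line u w :
  is_derive (0 : R) 1 (fun h : R => h *: w + u) w.
Proof.
apply: is_derive_eq (is_deriveD (is_derive_scale (is_derive_id _ _)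
  (is_derive_cst w _ _)) (is_derive_cst u _ _)) _.
by rewrite scaler0 addr0 scale1r addr0.
Qed.

(** Restricting to lines reduces gradients to derivatives in one variable, for
    which the rules above are available. *)
Lemma gradE (L : 'rV[R]_3 -> R) u v :
  (forall w, is_derive (0 : R) 1 (fun h => L (h *: w + u)) (dotmul v w)) ->
  grad L u = v.
Proof.
move=> dL; apply/rowP => i; rewrite mxE.
have -> : 'D_(delta_mx 0 i) L u =
    'D_1 (fun h : R => L (h *: delta_mx 0 i + u)) 0.
  rewrite /derive; set g1 := fun h => h^-1 *: _; set g2 := fun h => h^-1 *: _.
  suff -> : g1 = g2 by [].
  apply/funext => h; rewrite /g1 /g2 /=.
  by rewrite addr0 scale0r add0r [_%:A]mulr1.
have [_ ->] := dL (delta_mx 0 i).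
rewrite /dotmul (bigD1 i)//= !mxE !eqxx mulr1 big1 ?addr0// => j ji.
by rewrite mxE (negbTE ji) andbF mulr0.
Qed.

End VectorCalculus.

(** * Gradients of the elastic Lagrangian at unit speed *)

Section ElasticLagrangian.
Context {R : realType}.
Implicit Types q v a w : 'rV[R]_3.

Lemma grad_acc_elastic_lagrangian q v a : enorm v = 1 ->
  grad (elastic_lagrangian q v) a = 2 *: (a - dotmul v a *: v).
Proof.
move=> v1; apply: gradE => w; set l := fun h : R => h *: w + a.
have l0 : l 0 = a by rewrite /l scale0r add0r.
have dl : is_derive (0 : R) 1 l w by exact: is_derive_line.
have -> : (fun h => elastic_lagrangian q v (l h)) =
  (fun h => dotmul (l h) (l h)) - (fun h => dotmul v (l h)) ^+ 2.
  apply/funext => h.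
  by rewrite /elastic_lagrangian v1 !expr1n !divr1 enorm_sqr.
apply: is_derive_eq (is_deriveB (is_derive_dotmul dl dl)
  (is_deriveX 2 (is_derive_dotmul (is_derive_cst v _ _) dl))) _.
rewrite /= l0 /GRing.scale/=; row_ring.
Qed.

(** The term <v, a>^2 / |v|^5 does not contribute: it vanishes to second order
    at a v orthogonal to a. *)
Lemma grad_vel_elastic_lagrangian q v a : enorm v = 1 -> dotmul v a = 0 ->
  grad (fun v => elastic_lagrangian q v a) v = - (3 * dotmul a a) *: v.
Proof.
move=> v1 va0; apply: gradE => w; set l := fun h : R => h *: w + v.
have l0 : l 0 = v by rewrite /l scale0r add0r.
have dl : is_derive (0 : R) 1 l w by exact: is_derive_line.
have nz : l 0 != 0 by rewrite l0 -enorm_eq0 v1 oner_eq0.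
have dn := is_derive_enormV nz dl.
have -> : (fun h => elastic_lagrangian q (l h) a) =
  cst (dotmul a a) * (fun h => (enorm (l h))^-1) ^+ 3 -
  (fun h => dotmul (l h) a) ^+ 2 * (fun h => (enorm (l h))^-1) ^+ 5.
  by apply/funext => h; rewrite /elastic_lagrangian -!exprVn enorm_sqr.
apply: is_derive_eq (is_deriveB
  (is_deriveM (is_derive_cst _ _ _) (is_deriveX 3 dn))
  (is_deriveM (is_deriveX 2 (is_derive_dotmul dl (is_derive_cst a _ _)))
    (is_deriveX 5 dn))) _.
rewrite /= !exprfctE /= l0 va0 v1 dotmulZl /GRing.scale/=.
by field.
Qed.

End ElasticLagrangian.

(** * Momenta of an elastica parametrized by arclength *)

Section ArclengthElastica.
Context {R : realType}.
Context (I : set R) (x : R -> 'rV[R]_3) (openI : open I).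
Context (elx : elastica I x) (arcx : arclength_parametrized I x).
Implicit Type t : R.

Local Notation v := (derive1 x).
Local Notation a := (derive1n 2 x).
Local Notation b := (derive1n 3 x).
Local Notation p := (linear_momentum x).

Let near_I t (It : I t) : \forall s \near t, I s.
Proof. by apply: open_nbhs_nbhs; split. Qed.

Lemma is_derive_elastica k t : (k < 4)%N -> I t ->
  is_derive t 1 (derive1n k x) (derive1n k.+1 x t).
Proof.
case: elx => dx _ _ k4 It.
by rewrite derive1nS derive1E; apply: derivableP; exact: dx.
Qed.

Lemma arclength_velocity_sqr t : I t -> dotmul (v t) (v t) = 1.
Proof. by move=> It; rewrite -enorm_sqr arcx// expr1n. Qed.

Lemma arclength_acc_orthogonal t : I t -> dotmul (v t) (a t) = 0.
Proof.
move=> It; have dv := @is_derive_elastica 1 _ isT It.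
have := near_cst_dotmul (c := 1) dv dv.
rewrite [dotmul (derive1n 2 x t) _]dotmulC -mulr2n.
have /[swap]/[apply] : \forall s \near t, dotmul (v s) (v s) = 1.
  by near do rewrite arclength_velocity_sqr//; exact: near_I.
by move=> /eqP; rewrite mulrn_eq0/= => /eqP.
Unshelve. all: by end_near. Qed.

Lemma dL_dacc_elastica t : I t -> dL_dacc elastic_lagrangian x t = 2 *: a t.
Proof.
move=> It; rewrite /dL_dacc (grad_acc_elastic_lagrangian (x t) _ (arcx It)).
by rewrite arclength_acc_orthogonal// scale0r subr0.
Qed.

Lemma dL_dvel_elastica t : I t ->
  dL_dvel elastic_lagrangian x t = - (3 * dotmul (a t) (a t)) *: v t.
Proof.
move=> It; apply: grad_vel_elastic_lagrangian; first exact: arcx.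
exact: arclength_acc_orthogonal.
Qed.

Lemma derive1_dL_dacc_elastica t : I t ->
  derive1 (dL_dacc elastic_lagrangian x) t = 2 *: b t.
Proof.
move=> It; rewrite (@near_eq_derive1 _ _ (2 \*: a)).
  rewrite derive1E.
  have da := @is_derive_elastica 2 _ isT It.
  by have [_ ->] := is_deriveZ 2 da.
by near do rewrite dL_dacc_elastica//; exact: near_I.
Unshelve. all: by end_near. Qed.

Lemma linear_momentum_arclength t : I t ->
  p t = - (3 * dotmul (a t) (a t)) *: v t - 2 *: b t.
Proof.
move=> It; rewrite /linear_momentum /momentum_pos.
by rewrite dL_dvel_elastica// derive1_dL_dacc_elastica.
Qed.

(** As L does not depend on the position, the Euler-Lagrange equation is
    the vanishing of the derivative of p; what is left to check is that the
    two terms of p are separately derivable. *)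
Lemma is_derive_linear_momentum t : I t -> is_derive t 1 p 0.
Proof.
move=> It.
have dv := @is_derive_elastica 1 _ isT It.
have da := @is_derive_elastica 2 _ isT It.
have db := @is_derive_elastica 3 _ isT It.
have dcoef := is_deriveN (is_deriveZ 3 (is_derive_dotmul da da)).
have dvel : is_derive t 1 (dL_dvel elastic_lagrangian x)
    (derive1 (dL_dvel elastic_lagrangian x) t).
  rewrite derive1E; apply: derivableP.
  apply: near_eq_derivable
    (@ex_derive _ _ _ _ _ _ _ (is_derive_scale dcoef dv)).
  by near do rewrite dL_dvel_elastica//; exact: near_I.
have dacc : is_derive t 1 (derive1 (dL_dacc elastic_lagrangian x))
    (derive1n 2 (dL_dacc elastic_lagrangian x) t).
  rewrite derive1nS derive1E; apply: derivableP.
  apply: near_eq_derivable (@ex_derive _ _ _ _ _ _ _ (is_deriveZ 2 db)).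
  by near do rewrite derive1_dL_dacc_elastica//; exact: near_I.
apply: is_derive_eq (is_deriveB dvel dacc) _.
have [_ _ /(_ _ It)] := elx; rewrite /euler_lagrange.
have -> : dL_dpos elastic_lagrangian x t = 0.
  apply: gradE => w; apply: is_derive_eq (is_derive_cst _ _ _) _.
  by row_ring.
by rewrite sub0r addrC => /eqP; rewrite subr_eq0 => /eqP ->; rewrite subrr.
Unshelve. all: by end_near. Qed.

Lemma dotmul_velocity_momentum t : I t ->
  dotmul (v t) (p t) = - curvature x t ^+ 2.
Proof.
move=> It.
have dv := @is_derive_elastica 1 _ isT It.
have da := @is_derive_elastica 2 _ isT It.
have vb : dotmul (a t) (a t) + dotmul (v t) (b t) = 0.
  apply: (near_cst_dotmul (c := 0) dv da).
  by near do rewrite arclength_acc_orthogonal//; exact: near_I.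
rewrite linear_momentum_arclength// /curvature enorm_sqr.
have := arclength_velocity_sqr It; move: vb.
move: (v t) (a t) (b t) => V A B VB VV.
rewrite dotmulC dotmulDl -[- (2 *: B)]scaleNr !dotmulZl VV [dotmul B V]dotmulC; lra.
Unshelve. all: by end_near. Qed.

Lemma enorm_velocity_momentum_sqr t : I t ->
  enorm (crossmul (v t) (p t)) ^+ 2 = enorm (p t) ^+ 2 - curvature x t ^+ 4.
Proof.
move=> It; rewrite !enorm_sqr lagrange_identity arclength_velocity_sqr// mul1r.
by rewrite dotmul_velocity_momentum// sqrrN -exprM.
Qed.

Lemma dotmul_angular_linear_momentum t : I t ->
  dotmul (angular_momentum x t) (p t) =
  2 * dotmul (crossmul (v t) (a t)) (p t).
Proof.
move=> It; rewrite /angular_momentum /momentum_vel dL_dacc_elastica//.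
by move: (p t) (a t) (v t) (x t) => P A V X; row_ring.
Qed.

(** The derivative of N = a / kappa is b / kappa up to a multiple of a, which
    is orthogonal to B = v x a / kappa. *)
Lemma curvature_sqr_torsion t : I t ->
  curvature x t ^+ 2 * torsion x t = dotmul (crossmul (v t) (a t)) (b t).
Proof.
move=> It; have da := @is_derive_elastica 2 _ isT It.
have [a0|a0] := eqVneq (a t) 0.
  have -> : curvature x t = 0 by apply/eqP; rewrite /curvature enorm_eq0 a0.
  by rewrite expr0n mul0r a0; move: (v t) (b t) => V B; row_ring.
have k0 : curvature x t != 0 by rewrite enorm_eq0.
have dN := is_derive_scale (is_derive_enormV a0 da) da.
rewrite /torsion derive1E (@derive_val _ _ _ _ _ _ _ dN).
rewrite /frenet_binormal /frenet_normal /frenet_tangent.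
rewrite -[derive1 v]/(derive1n 2 x) -/(curvature x t).
move: (curvature x t) k0 (b t) (a t) (v t) => k k0 B A V.
have -> (m e : R) : dotmul (e *: A + m *: B) (crossmul V (m *: A)) =
  m ^+ 2 * dotmul (crossmul V A) B by row_ring.
by field.
Qed.

Lemma dotmul_velocity_acc_momentum t : I t ->
  dotmul (crossmul (v t) (a t)) (p t) =
  - 2 * (curvature x t ^+ 2 * torsion x t).
Proof.
move=> It; rewrite curvature_sqr_torsion// linear_momentum_arclength//.
by move: (b t) (a t) (v t) => B A V; row_ring.
Qed.

End ArclengthElastica.

(** * The rotating frame *)

Theorem proposition3p6 (R : realType) (I : set R) (x : R -> 'rV[R]_3)
    (openI : open I) (itvI : is_interval I)
    (elx : elastica I x) (arcx : arclength_parametrized I x)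
    (t : R) (It : I t) (npar : ~ parallel (derive1 x t) (linear_momentum x t)) :
  let p := linear_momentum x t in
  let l := angular_momentum x t in
  let kappa := curvature x t in
  let omega :=
    dotmul l p * enorm p / (2 * (enorm p ^+ 2 - kappa ^+ 4)) in
  [/\ is_derive t (1 : R) (frameD x) (- omega *: frameE x t),
      is_derive t (1 : R) (frameE x) (omega *: frameD x t) &
      kappa ^+ 2 * torsion x t = - (1 / 4) * dotmul l p].
Proof.
move=> p l kappa omega.
set w := crossmul (derive1 x t) p.
pose det := dotmul (crossmul (derive1 x t) (derive1n 2 x t)) p.
have lpE : dotmul l p = 2 * det.
  exact: dotmul_angular_linear_momentum openI elx arcx _ It.
have nw2 : enorm w ^+ 2 = enorm p ^+ 2 - kappa ^+ 4.
  exact: enorm_velocity_momentum_sqr openI elx arcx _ It.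
have v0 : derive1 x t != 0 by rewrite -enorm_eq0 arcx// oner_eq0.
have w0 : w != 0 by apply/eqP => /(crossmul_eq0_parallel v0).
have p0 : p != 0.
  by apply/eqP => p0; apply: npar; right; exists 0; rewrite scale0r.
have nw0 : enorm w != 0 by rewrite enorm_eq0.
have np0 : enorm p != 0 by rewrite enorm_eq0.
have wp0 : dotmul w p = 0 by exact: dotmul_crossmulr.
have nwp := enorm_crossmul_orthogonal wp0.
have nwp0 : crossmul w p != 0 by rewrite -enorm_eq0 nwp mulf_neq0.
have dp := is_derive_linear_momentum openI elx arcx It.
have dv : is_derive t 1 (derive1 x) (derive1n 2 x t).
  exact: is_derive_elastica elx 1 _ isT It.
have dw := is_derive_crossmul_stationary dv dp.
split.
- have dD := is_derive_normalize_crossmul dv dp w0.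
  apply: is_derive_eq dD _.
  rewrite /frameE /normalize scalerA -/p -/w nwp; congr (_ *: _).
  by rewrite /omega lpE -nw2 -/det; field; rewrite nw0 np0.
- have dE := is_derive_normalize_crossmul dw dp nwp0.
  apply: is_derive_eq dE _.
  rewrite /frameD /normalize scalerA -/p -/w crossmul_crossmul wp0.
  rewrite scale0r sub0r scalerN -scaleNr scalerA nwp; congr (_ *: _).
  rewrite dotmul_crossmul_crossmul -/det.
  by rewrite /omega lpE -enorm_sqr -nw2; field; rewrite nw0 np0.
- rewrite lpE [det](dotmul_velocity_acc_momentum openI elx arcx It) -/kappa.
  by field.
Qed.
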